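(* Let $n\in\mathbb{Z}$. For an $n$-graded double bracket $\{\!\!\{-,-\}\!\!\}$ in a graded algebra $A$, a cyclic bilinear form $v$ on a coalgebra $M$, and any $\theta\in M$ adjoint to $v$, the trace $\mathrm{tr}_\theta:\check A\to A_M$ carries the bracket $\langle-,-\rangle$ in $\check A$ to the bracket $\{-,-\}_v$ in $A_M$, i.e. $\{\mathrm{tr}_\theta(x),\mathrm{tr}_\theta(y)\}_v=\mathrm{tr}_\theta(\langle x,y\rangle)$ for all $x,y\in\check A$. Consequently, the algebra $A(\theta)$ is closed under the bracket $\{-,-\}_v$.
   Context: All modules, (co)algebras and tensor products are over a fixed commutative ring $\mathbb{K}$. Algebras are associative, not necessarily unital; coalgebras are coassociative, not necessarily counital, and not graded. Graded means $\mathbb{Z}$-graded, $|a|$ is the degree of a homogeneous element $a$, and $|a|_n=|a|+n$. Iterated comultiplication in $M$ is written $\alpha\mapsto\alpha^1\otimes\cdots\otimes\alpha^m$ (summation suppressed). Elements of $A\otimes A$ are written $x=x'\otimes x''$ (summation suppressed, homogeneous factors). Representation algebra: $A_M$ is the graded algebra generated by symbols $a_\alpha$ ($a\in A$, $\alpha\in M$), $|a_\alpha|=|a|$, subject to bilinearity of $a_\alpha$ in $(a,\alpha)$, $(ab)_\alpha=a_{\alpha^1}b_{\alpha^2}$, and $a_\alpha b_\beta=(-1)^{|a||b|}b_\beta a_\alpha$ for homogeneous $a,b$. Double brackets: let $P_{21,n}(a\otimes b)=(-1)^{|a|_n|b|_n}b\otimes a$, $P_{21}=P_{21,0}$. Put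 $a(x\otimes y)b=ax\otimes yb$ and $a*(x\otimes y)*b=(-1)^{|a||xb|+|b||y|}xb\otimes ay$. An $n$-graded double bracket in $A$ is a linear endomorphism $\{\!\!\{-,-\}\!\!\}$ of $A^{\otimes2}$ such that $\{\!\!\{A^p,A^q\}\!\!\}\subset\bigoplus_{i+j=p+q+n}A^i\otimes A^j$; $\{\!\!\{-,-\}\!\!\}P_{21,n}=-P_{21}\{\!\!\{-,-\}\!\!\}$; $\{\!\!\{a,bc\}\!\!\}=\{\!\!\{a,b\}\!\!\}c+(-1)^{|a|_n|b|}b\{\!\!\{a,c\}\!\!\}$; $\{\!\!\{ab,c\}\!\!\}=a*\{\!\!\{b,c\}\!\!\}+(-1)^{|b||c|_n}\{\!\!\{a,c\}\!\!\}*b$ for homogeneous $a,b,c$. Cyclic forms: $v:M\otimes M\to\mathbb{K}$ is cyclic if $\widehat v(\alpha\otimes\beta)=v(\alpha\otimes\beta^2)\beta^1\otimes\beta^3$ commutes with the flip of $M\otimes M$. An element $\theta\in M$ is adjoint to $v$ if the map $M\to\mathbb{K}$, $\alpha\mapsto v(\theta\otimes\alpha)$, is a counit of $M$. Induced bracket: an $n$-graded biderivation in a graded algebra $B$ is a linear bracket with $\{B^p,B^q\}\subset B^{p+q+n}$, $\{a,bc\}=\{a,b\}c+(-1)^{|a|_n|b|}b\{a,c\}$, $\{ab,c\}=a\{b,c\}+(-1)^{|b||c|_n}\{a,c\}b$, $\{a,b\}=-(-1)^{|a|_n|b|_n}\{b,a\}$. $\{-,-\}_v$ is the unique $n$-graded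 biderivation in $A_M$ with $\{a_\alpha,b_\beta\}_v=v(\alpha\otimes\beta^2)\{\!\!\{a,b\}\!\!\}'_{\beta^1}\{\!\!\{a,b\}\!\!\}''_{\beta^3}$ for all $a,b\in A$, $\alpha,\beta\in M$. Bracket on $\check A$: $[A,A]\subset A$ is the submodule spanned by $ab-(-1)^{|a||b|}ba$ for homogeneous $a,b\in A$, and $\check A=A/[A,A]$. The bilinear map $A\times A\to A$, $(a,b)\mapsto\{\!\!\{a,b\}\!\!\}'\{\!\!\{a,b\}\!\!\}''$ (the product in $A$ of the two tensor factors) descends to a bilinear bracket $\langle-,-\rangle:\check A\times\check A\to\check A$. Traces: $\mathrm{tr}_\theta:A\to A_M$ is $a\mapsto a_\theta$; for $\theta$ adjoint to a cyclic form it vanishes on $[A,A]$ and so induces a linear map $\mathrm{tr}_\theta:\check A\to A_M$ (the trace). $A(\theta)$ is the subalgebra of $A_M$ generated by $\{a_\theta\}_{a\in A}$. *)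

(* Defs.v *)
From HB Require Import structures.
From mathcomp Require Import all_boot all_order all_algebra finmap.
From mathcomp Require Import boolp.
From mathcomp Require Import zify.

Set Implicit Arguments.
Unset Strict Implicit.
Unset Printing Implicit Defensive.

Import GRing.Theory.
Local Open Scope ring_scope.
Local Open Scope quotient_scope.

(* A K-module "up to an equivalence relation"; its quotient is a genuine
   lmodType. Tensor products, A/[A,A] and A_M are all obtained this way. *)
Record preLmod (K : comPzRingType) := PreLmod {
  pl_sort :> Type;
  pl_eq : pl_sort -> pl_sort -> Prop;
  pl0 : pl_sort;
  plD : pl_sort -> pl_sort -> pl_sort;
  plZ : K -> pl_sort -> pl_sort;
  pl_refl : forall x, pl_eq x x;
  pl_sym : forall x y, pl_eq x y -> pl_eq y x;
  pl_trans : forall x y z, pl_eq x y -> pl_eq y z -> pl_eq x z;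
  plD_eq : forall x x' y y',
    pl_eq x x' -> pl_eq y y' -> pl_eq (plD x y) (plD x' y');
  plZ_eq : forall k x x', pl_eq x x' -> pl_eq (plZ k x) (plZ k x');
  plDA : forall x y z, pl_eq (plD x (plD y z)) (plD (plD x y) z);
  plDC : forall x y, pl_eq (plD x y) (plD y x);
  pl0D : forall x, pl_eq (plD pl0 x) x;
  plZA : forall k l x, pl_eq (plZ k (plZ l x)) (plZ (k * l) x);
  pl1Z : forall x, pl_eq (plZ 1 x) x;
  plZDr : forall k x y, pl_eq (plZ k (plD x y)) (plD (plZ k x) (plZ k y));
  plZDl : forall k l x, pl_eq (plZ (k + l) x) (plD (plZ k x) (plZ l x));
  pl0Z : forall x, pl_eq (plZ 0 x) pl0
}.
Arguments pl_eq {K} p.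
Arguments pl0 {K} p.
Arguments plD {K} p.
Arguments plZ {K} p.

Section Quotient.
Variables (K : comPzRingType) (P : preLmod K).

Definition pl_rel : rel {classic P} := fun x y => `[< pl_eq P x y >].

Lemma pl_rel_equiv : equiv_class_of pl_rel.
Proof.
split=> [x | x y | y x z].
- exact/asboolP/pl_refl.
- by apply/asboolP/asboolP; apply: pl_sym.
- by move=> /asboolP xy /asboolP yz; apply/asboolP; apply: pl_trans xy yz.
Qed.

Canonical pl_rel_equiv_rel := EquivRelPack pl_rel_equiv.

Definition pl_quot : Type := {eq_quot pl_rel}.
HB.instance Definition _ := Choice.on pl_quot.
HB.instance Definition _ := EqQuotient.on pl_quot.

Definition pl_pi (x : P) : pl_quot := \pi_pl_quot (x : {classic P}).
Definition pl_repr (q : pl_quot) : P := (repr q : {classic P}).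

Lemma pl_reprK q : pl_pi (pl_repr q) = q.
Proof. exact: reprK. Qed.

Lemma pl_piP x y : pl_pi x = pl_pi y <-> pl_eq P x y.
Proof.
split=> [/eqP|xy]; first by rewrite piE => /asboolP.
by apply/eqP; rewrite piE; apply/asboolP.
Qed.

Lemma pl_repr_pi x : pl_eq P (pl_repr (pl_pi x)) x.
Proof. by apply/pl_piP; rewrite pl_reprK. Qed.

Lemma pl_quotW (S : pl_quot -> Prop) : (forall x, S (pl_pi x)) -> forall q, S q.
Proof. by move=> Spi q; rewrite -(pl_reprK q). Qed.

Definition plq_add x y := pl_pi (plD P (pl_repr x) (pl_repr y)).
Definition plq_scale k x := pl_pi (plZ P k (pl_repr x)).
Definition plq_opp x := plq_scale (-1) x.

Lemma plq_addE x y : plq_add (pl_pi x) (pl_pi y) = pl_pi (plD P x y).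
Proof. by apply/pl_piP/plD_eq; apply: pl_repr_pi. Qed.

Lemma plq_scaleE k x : plq_scale k (pl_pi x) = pl_pi (plZ P k x).
Proof. by apply/pl_piP/plZ_eq; apply: pl_repr_pi. Qed.

Lemma plq_addA : associative plq_add.
Proof.
elim/pl_quotW=> x; elim/pl_quotW=> y; elim/pl_quotW=> z.
by rewrite !plq_addE; apply/pl_piP/plDA.
Qed.

Lemma plq_addC : commutative plq_add.
Proof.
by elim/pl_quotW=> x; elim/pl_quotW=> y; rewrite !plq_addE; apply/pl_piP/plDC.
Qed.

Lemma plq_add0 : left_id (pl_pi (pl0 P)) plq_add.
Proof. by elim/pl_quotW=> x; rewrite plq_addE; apply/pl_piP/pl0D. Qed.

Lemma plq_scaleDl x : {morph plq_scale^~ x : k l / k + l >-> plq_add k l}.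
Proof.
move=> k l; elim/pl_quotW: x => x.
by rewrite !plq_scaleE plq_addE; apply/pl_piP/plZDl.
Qed.

Lemma plq_scale1 : left_id 1 plq_scale.
Proof. by elim/pl_quotW=> x; rewrite plq_scaleE; apply/pl_piP/pl1Z. Qed.

Lemma plq_addN : left_inverse (pl_pi (pl0 P)) plq_opp plq_add.
Proof.
move=> x; rewrite -[X in plq_add _ X]plq_scale1 -plq_scaleDl addNr.
by elim/pl_quotW: x => x; rewrite plq_scaleE; apply/pl_piP/pl0Z.
Qed.

HB.instance Definition _ :=
  GRing.isZmodule.Build pl_quot plq_addA plq_addC plq_add0 plq_addN.

Lemma plq_scaleA k l x : plq_scale k (plq_scale l x) = plq_scale (k * l) x.
Proof. by elim/pl_quotW: x => x; rewrite !plq_scaleE; apply/pl_piP/plZA. Qed.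

Lemma plq_scaleDr : right_distributive plq_scale +%R.
Proof.
move=> k; elim/pl_quotW=> x; elim/pl_quotW=> y.
have addE (u w : pl_quot) : u + w = plq_add u w by [].
by rewrite !addE plq_addE !plq_scaleE plq_addE; apply/pl_piP/plZDr.
Qed.

HB.instance Definition _ := GRing.Zmodule_isLmodule.Build K pl_quot
  plq_scaleA plq_scale1 plq_scaleDr plq_scaleDl.

Lemma pl_pi0 : pl_pi (pl0 P) = 0. Proof. by []. Qed.
Lemma pl_piD x y : pl_pi (plD P x y) = pl_pi x + pl_pi y.
Proof. by rewrite -(plq_addE x y). Qed.
Lemma pl_piZ k x : pl_pi (plZ P k x) = k *: pl_pi x.
Proof. by rewrite -(plq_scaleE k x). Qed.

End Quotient.

Definition bilin (K : pzRingType) (U V W : lmodType K) (f : U -> V -> W) : Prop :=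
  (forall u, linear (f u)) /\ (forall v, linear (f^~ v)).

Inductive span (K : pzRingType) (U : lmodType K) (S : U -> Prop) : U -> Prop :=
| span_gen x : S x -> span S x
| span0 : span S 0
| spanD x y : span S x -> span S y -> span S (x + y)
| spanZ k x : span S x -> span S (k *: x).

(* The tensor product of two K-modules: generators u (x) v, bilinear relations. *)
Section Tensor.
Variables (K : comPzRingType) (U V : lmodType K).

Inductive tterm : Type :=
| TPure of U & V
| T0
| TD of tterm & tterm
| TZ of K & tterm.

Inductive teq : tterm -> tterm -> Prop :=
| teq_refl x : teq x x
| teq_sym x y : teq x y -> teq y x
| teq_trans x y z : teq x y -> teq y z -> teq x z
| teqD x x' y y' : teq x x' -> teq y y' -> teq (TD x y) (TD x' y')
| teqZ k x x' : teq x x' -> teq (TZ k x) (TZ k x')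
| teqDA x y z : teq (TD x (TD y z)) (TD (TD x y) z)
| teqDC x y : teq (TD x y) (TD y x)
| teq0D x : teq (TD T0 x) x
| teqZA k l x : teq (TZ k (TZ l x)) (TZ (k * l) x)
| teq1Z x : teq (TZ 1 x) x
| teqZDr k x y : teq (TZ k (TD x y)) (TD (TZ k x) (TZ k y))
| teqZDl k l x : teq (TZ (k + l) x) (TD (TZ k x) (TZ l x))
| teq0Z x : teq (TZ 0 x) T0
| teq_pureDl u u' v : teq (TPure (u + u') v) (TD (TPure u v) (TPure u' v))
| teq_pureZl k u v : teq (TPure (k *: u) v) (TZ k (TPure u v))
| teq_pureDr u v v' : teq (TPure u (v + v')) (TD (TPure u v) (TPure u v'))
| teq_pureZr k u v : teq (TPure u (k *: v)) (TZ k (TPure u v)).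

Definition tens_pre : preLmod K :=
  PreLmod teq_refl teq_sym teq_trans teqD teqZ teqDA teqDC teq0D teqZA teq1Z
    teqZDr teqZDl teq0Z.

Definition tensor : Type := pl_quot tens_pre.
HB.instance Definition _ := GRing.Lmodule.on tensor.

Definition tens_pi : tterm -> tensor := @pl_pi K tens_pre.
Definition tens (u : U) (v : V) : tensor := tens_pi (TPure u v).

Lemma tens_piP x y : tens_pi x = tens_pi y <-> teq x y.
Proof. exact: (@pl_piP K tens_pre). Qed.
Lemma tens_pi0 : tens_pi T0 = 0. Proof. by []. Qed.
Lemma tens_piD x y : tens_pi (TD x y) = tens_pi x + tens_pi y.
Proof. exact: (@pl_piD K tens_pre). Qed.
Lemma tens_piZ k x : tens_pi (TZ k x) = k *: tens_pi x.
Proof. exact: (@pl_piZ K tens_pre). Qed.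
Lemma tens_piW (S : tensor -> Prop) : (forall x, S (tens_pi x)) -> forall t, S t.
Proof. exact: (@pl_quotW K tens_pre). Qed.

Lemma tens_bilin : bilin tens.
Proof.
split=> [u k v v' | v k u u']; rewrite /tens -tens_piZ -tens_piD; apply/tens_piP.
- by apply: teq_trans (teq_pureDr _ _ _) (teqD (teq_pureZr _ _ _) (teq_refl _)).
- by apply: teq_trans (teq_pureDl _ _ _) (teqD (teq_pureZl _ _ _) (teq_refl _)).
Qed.

Lemma tensorW (S : tensor -> Prop) :
  S 0 -> (forall k u v t, S t -> S (k *: tens u v + t)) -> forall t, S t.
Proof.
move=> S0 SD.
suff H x k t : S t -> S (k *: tens_pi x + t).
  by elim/tens_piW => x; move: (H x 1 0 S0); rewrite scale1r addr0.
elim: x k t => [u v k t | k t | x IHx y IHy k t | l x IHx k t] St.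
- exact: SD.
- by rewrite tens_pi0 scaler0 add0r.
- by rewrite tens_piD scalerDr -addrA; apply/IHx/IHy.
- by rewrite tens_piZ scalerA; apply: IHx.
Qed.

Section Lift.
Variables (W : lmodType K) (f : U -> V -> W).

Fixpoint teval (t : tterm) : W :=
  match t with
  | TPure u v => f u v
  | T0 => 0
  | TD x y => teval x + teval y
  | TZ k x => k *: teval x
  end.

(* The linear map u (x) v |-> f u v; meaningful when f is bilinear (tliftE). *)
Definition tlift (t : tensor) : W := teval (pl_repr t).

Hypothesis f_bilin : bilin f.

Lemma teval_eq s t : teq s t -> teval s = teval t.
Proof.
have [fr fl] := f_bilin.
have f0r u : f u 0 = 0 by have:= fr u (-1) 0 0; rewrite !scaleN1r !addr0 oppr0 addNr.
have f0l v : f 0 v = 0 by have:= fl v (-1) 0 0; rewrite !scaleN1r !addr0 oppr0 addNr.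
elim=> //= {s t}.
- by move=> x y z _ -> _ ->.
- by move=> x x' y y' _ -> _ ->.
- by move=> k x x' _ ->.
- by move=> *; rewrite addrA.
- by move=> *; rewrite addrC.
- by move=> *; rewrite add0r.
- by move=> *; rewrite scalerA.
- by move=> *; rewrite scale1r.
- by move=> *; rewrite scalerDr.
- by move=> *; rewrite scalerDl.
- by move=> *; rewrite scale0r.
- by move=> u u' v; rewrite -[u]scale1r fl !scale1r.
- by move=> k u v; rewrite -[k *: u]addr0 fl f0l addr0.
- by move=> u v v'; rewrite -[v]scale1r fr !scale1r.
- by move=> k u v; rewrite -[k *: v]addr0 fr f0r addr0.
Qed.

Lemma tlift_pi x : tlift (tens_pi x) = teval x.
Proof. by apply: teval_eq; apply: (@pl_repr_pi K tens_pre). Qed.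

Lemma tliftE u v : tlift (tens u v) = f u v.
Proof. exact: tlift_pi. Qed.

Lemma tlift_linear : linear tlift.
Proof.
move=> k; elim/tens_piW => x; elim/tens_piW => y.
by rewrite -tens_piZ -tens_piD !tlift_pi.
Qed.

End Lift.
End Tensor.

Notation "u \ot v" := (tens u v) (at level 40, left associativity) : ring_scope.

Section TensorMaps.
Variable K : comPzRingType.

Definition tmap (U V U' V' : lmodType K) (f : U -> U') (g : V -> V') :
  tensor U V -> tensor U' V' := tlift (fun u v => f u \ot g v).

Definition tassoc (U V W : lmodType K) :
  tensor (tensor U V) W -> tensor U (tensor V W) :=
  tlift (fun t w => tlift (fun u v => u \ot (v \ot w)) t).

Definition tflip (U V : lmodType K) : tensor U V -> tensor V U :=
  tlift (fun u v => v \ot u).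

End TensorMaps.

(* Coassociative coalgebras, not necessarily counital. *)
Record coalgebra (K : comPzRingType) := Coalgebra {
  co_sort :> lmodType K;
  comul : {linear co_sort -> tensor co_sort co_sort};
  comulA : forall x,
    tassoc (tmap comul id (comul x)) = tmap id comul (comul x)
}.
Arguments comul {K} c.

Section Coalgebras.
Variables (K : comPzRingType) (M : coalgebra K).

(* sweedler2 f x = f x^1 x^2 and sweedler3 f x = f x^1 x^2 x^3, summation
   suppressed, for f multilinear. *)
Definition sweedler2 (W : lmodType K) (f : M -> M -> W) (x : M) : W :=
  tlift f (comul M x).

Definition sweedler3 (W : lmodType K) (f : M -> M -> M -> W) (x : M) : W :=
  tlift (fun x1 x23 => tlift (f x1) x23) (tmap id (comul M) (comul M x)).

Definition is_counit (e : M -> K) : Prop :=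
  forall x, sweedler2 (fun x1 x2 => e x1 *: x2) x = x /\
            sweedler2 (fun x1 x2 => e x2 *: x1) x = x.

Variable v : {scalar tensor M M}.

Definition vhat : tensor M M -> tensor M M :=
  tlift (fun x y => sweedler3 (fun y1 y2 y3 => v (x \ot y2) *: (y1 \ot y3)) y).

Definition is_cyclic : Prop := forall t, vhat (tflip t) = tflip (vhat t).

Definition is_adjoint (theta : M) : Prop :=
  is_counit (fun x => v (theta \ot x)).

End Coalgebras.

(* Associative algebras, not necessarily unital. *)
Record algebra (K : comPzRingType) := Algebra {
  alg_sort :> lmodType K;
  amul : alg_sort -> alg_sort -> alg_sort;
  amulA : associative amul;
  amul_bilin : bilin amul
}.
Arguments amul {K a}.

Notation "x ** y" := (amul x y) (at level 40, left associativity) : ring_scope.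

(* Z-graded algebras: gcomp a p is the component of a in degree p. *)
Record galgebra (K : comPzRingType) := GAlgebra {
  galg :> algebra K;
  gcomp : galg -> {fsfun int -> galg with 0};
  gcomp_linear : forall p, linear (fun a => gcomp a p);
  gcompE : forall a, a = \sum_(p <- finsupp (gcomp a)) gcomp a p;
  gcompK : forall a p q, gcomp (gcomp a p) q = if p == q then gcomp a p else 0;
  gcomp_mul : forall a b p q, gcomp a p = a -> gcomp b q = b ->
    gcomp (a ** b) (p + q) = a ** b
}.
Arguments gcomp {K g}.

(* The sign (-1)^m in K; only the parity of the integer m matters. *)
Definition sgn (K : comPzRingType) (m : int) : K := (-1) ^+ `|m|%N.
Arguments sgn {K}.

Section GradedAlgebras.
Variables (K : comPzRingType) (A : galgebra K).

Definition homog (p : int) (a : A) : Prop := gcomp a p = a.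

(* \sum_p F p a_p, where a = \sum_p a_p is the homogeneous decomposition; it
   extends linearly to A the formulas which involve degrees. *)
Definition gsum (W : lmodType K) (F : int -> A -> W) (a : A) : W :=
  \sum_(p <- finsupp (gcomp a)) F p (gcomp a p).

Definition tens_homog (r : int) : tensor A A -> Prop :=
  span (fun t => exists i j x y,
    [/\ i + j = r, homog i x, homog j y & t = x \ot y]).

Definition P21n (n : int) : tensor A A -> tensor A A :=
  tlift (fun a b => gsum (fun p a' => gsum (fun q b' =>
    sgn ((p + n) * (q + n)) *: (b' \ot a')) b) a).

Definition P21 := P21n 0.

Definition lact (a : A) : tensor A A -> tensor A A :=
  tlift (fun x y => (a ** x) \ot y).
Definition ract (t : tensor A A) (b : A) : tensor A A :=
  tlift (fun x y => x \ot (y ** b)) t.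

(* a * (x (x) y) = (-1)^{|a||x|} x (x) a y,
   (x (x) y) * b = (-1)^{|b||y|} x b (x) y. *)
Definition lstar (a : A) : tensor A A -> tensor A A :=
  tlift (fun x y => gsum (fun p a' => gsum (fun q x' =>
    sgn (p * q) *: (x' \ot (a' ** y))) x) a).
Definition rstar (t : tensor A A) (b : A) : tensor A A :=
  tlift (fun x y => gsum (fun p b' => gsum (fun q y' =>
    sgn (p * q) *: ((x ** b') \ot y')) y) b) t.

Record is_double_bracket (n : int) (D : {linear tensor A A -> tensor A A}) :
    Prop := IsDoubleBracket {
  db_deg : forall p q a b, homog p a -> homog q b ->
    tens_homog (p + q + n) (D (a \ot b));
  db_anti : forall t, D (P21n n t) = - P21 (D t);
  db_derr : forall p q r a b c, homog p a -> homog q b -> homog r c ->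
    D (a \ot (b ** c)) =
      ract (D (a \ot b)) c + sgn ((p + n) * q) *: lact b (D (a \ot c));
  db_derl : forall p q r a b c, homog p a -> homog q b -> homog r c ->
    D ((a ** b) \ot c) =
      lstar a (D (b \ot c)) + sgn (q * (r + n)) *: rstar (D (a \ot c)) b
}.

(* [A,A] and A/[A,A]. *)
Definition commutators : A -> Prop :=
  span (fun x => exists p q a b,
    [/\ homog p a, homog q b & x = a ** b - sgn (p * q) *: (b ** a)]).

Definition comm_eq (x y : A) : Prop := commutators (x - y).

Lemma comm_eq_refl x : comm_eq x x.
Proof. by rewrite /comm_eq subrr; apply: span0. Qed.
Lemma comm_eq_sym x y : comm_eq x y -> comm_eq y x.
Proof. by move=> xy; rewrite /comm_eq -opprB -scaleN1r; apply: spanZ. Qed.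
Lemma comm_eq_trans x y z : comm_eq x y -> comm_eq y z -> comm_eq x z.
Proof.
move=> xy yz; rewrite /comm_eq (_ : x - z = (x - y) + (y - z)).
  exact: spanD.
by rewrite addrA subrK.
Qed.
Lemma comm_eqD x x' y y' :
  comm_eq x x' -> comm_eq y y' -> comm_eq (x + y) (x' + y').
Proof. by move=> xx yy; rewrite /comm_eq opprD addrACA; apply: spanD. Qed.
Lemma comm_eqZ k x x' : comm_eq x x' -> comm_eq (k *: x) (k *: x').
Proof. by move=> xx; rewrite /comm_eq -scalerBr; apply: spanZ. Qed.
Lemma comm_eqE x y : x = y -> comm_eq x y.
Proof. by move=> ->; apply: comm_eq_refl. Qed.

Definition check_pre : preLmod K :=
  @PreLmod K A comm_eq 0 +%R *:%R comm_eq_refl comm_eq_sym comm_eq_trans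
    comm_eqD comm_eqZ
    (fun x y z => comm_eqE (addrA x y z)) (fun x y => comm_eqE (addrC x y))
    (fun x => comm_eqE (add0r x)) (fun k l x => comm_eqE (scalerA k l x))
    (fun x => comm_eqE (scale1r x)) (fun k x y => comm_eqE (scalerDr k x y))
    (fun k l x => comm_eqE (scalerDl x k l)) (fun x => comm_eqE (scale0r x)).

Definition check : Type := pl_quot check_pre.
HB.instance Definition _ := GRing.Lmodule.on check.

Definition check_pi (a : A) : check := pl_pi (P := check_pre) a.
Definition check_repr (x : check) : A := pl_repr x.

Definition tmul : tensor A A -> A := tlift (@amul K A).

(* The bracket on A/[A,A], computed on representatives; see check_bracketE. *)
Definition check_bracket (D : {linear tensor A A -> tensor A A})
    (x y : check) : check :=
  check_pi (tmul (D (check_repr x \ot check_repr y))).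

End GradedAlgebras.
Arguments tmul {K A}.

(* The representation algebra A_M, presented as a (non-unital) K-algebra by
   generators RGen a x and relations. *)
Section Representation.
Variables (K : comPzRingType) (A : galgebra K) (M : coalgebra K).

Inductive rterm : Type :=
| RGen of A & M
| R0
| RD of rterm & rterm
| RZ of K & rterm
| RM of rterm & rterm.

(* In req_genM, s is any expression of the comultiplication of x as a sum of
   pure tensors. *)
Inductive req : rterm -> rterm -> Prop :=
| req_refl x : req x x
| req_sym x y : req x y -> req y x
| req_trans x y z : req x y -> req y z -> req x z
| reqD x x' y y' : req x x' -> req y y' -> req (RD x y) (RD x' y')
| reqZ k x x' : req x x' -> req (RZ k x) (RZ k x')
| reqM x x' y y' : req x x' -> req y y' -> req (RM x y) (RM x' y')
| reqDA x y z : req (RD x (RD y z)) (RD (RD x y) z)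
| reqDC x y : req (RD x y) (RD y x)
| req0D x : req (RD R0 x) x
| reqZA k l x : req (RZ k (RZ l x)) (RZ (k * l) x)
| req1Z x : req (RZ 1 x) x
| reqZDr k x y : req (RZ k (RD x y)) (RD (RZ k x) (RZ k y))
| reqZDl k l x : req (RZ (k + l) x) (RD (RZ k x) (RZ l x))
| req0Z x : req (RZ 0 x) R0
| reqMA x y z : req (RM x (RM y z)) (RM (RM x y) z)
| reqMDl x y z : req (RM (RD x y) z) (RD (RM x z) (RM y z))
| reqMDr x y z : req (RM x (RD y z)) (RD (RM x y) (RM x z))
| reqMZl k x y : req (RM (RZ k x) y) (RZ k (RM x y))
| reqMZr k x y : req (RM x (RZ k y)) (RZ k (RM x y))
| req_genDl a b x : req (RGen (a + b) x) (RD (RGen a x) (RGen b x))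
| req_genZl k a x : req (RGen (k *: a) x) (RZ k (RGen a x))
| req_genDr a x y : req (RGen a (x + y)) (RD (RGen a x) (RGen a y))
| req_genZr k a x : req (RGen a (k *: x)) (RZ k (RGen a x))
| req_genM a b x (s : seq (M * M)) :
    comul M x = \sum_(z <- s) z.1 \ot z.2 ->
    req (RGen (a ** b) x)
        (foldr (fun z t => RD (RM (RGen a z.1) (RGen b z.2)) t) R0 s)
| req_genC p q a b x y : homog p a -> homog q b ->
    req (RM (RGen a x) (RGen b y)) (RZ (sgn (p * q)) (RM (RGen b y) (RGen a x))).

Definition rep_pre : preLmod K :=
  PreLmod req_refl req_sym req_trans reqD reqZ reqDA reqDC req0D reqZA req1Z
    reqZDr reqZDl req0Z.

Definition rep : Type := pl_quot rep_pre.
HB.instance Definition _ := GRing.Lmodule.on rep.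

Definition rep_pi : rterm -> rep := @pl_pi K rep_pre.
Definition rep_repr : rep -> rterm := @pl_repr K rep_pre.

Definition rep_mul (x y : rep) : rep := rep_pi (RM (rep_repr x) (rep_repr y)).

Lemma rep_piP x y : rep_pi x = rep_pi y <-> req x y.
Proof. exact: (@pl_piP K rep_pre). Qed.
Lemma rep_pi0 : rep_pi R0 = 0. Proof. by []. Qed.
Lemma rep_piD x y : rep_pi (RD x y) = rep_pi x + rep_pi y.
Proof. exact: (@pl_piD K rep_pre). Qed.
Lemma rep_piZ k x : rep_pi (RZ k x) = k *: rep_pi x.
Proof. exact: (@pl_piZ K rep_pre). Qed.
Lemma rep_piM x y : rep_pi (RM x y) = rep_mul (rep_pi x) (rep_pi y).
Proof.
by apply/rep_piP/reqM; apply/rep_piP; rewrite /rep_pi /rep_repr pl_reprK.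
Qed.
Lemma rep_piW (S : rep -> Prop) : (forall x, S (rep_pi x)) -> forall t, S t.
Proof. exact: (@pl_quotW K rep_pre). Qed.

Lemma rep_mulA : associative rep_mul.
Proof.
elim/rep_piW => x; elim/rep_piW => y; elim/rep_piW => z.
by rewrite -!rep_piM; apply/rep_piP/reqMA.
Qed.

Lemma rep_mul_bilin : bilin rep_mul.
Proof.
split; elim/rep_piW => x k; elim/rep_piW => y; elim/rep_piW => z;
  rewrite -rep_piZ -rep_piD -!rep_piM -rep_piZ -rep_piD; apply/rep_piP.
- exact: req_trans (reqMDr _ _ _) (reqD (reqMZr _ _ _) (req_refl _)).
- exact: req_trans (reqMDl _ _ _) (reqD (reqMZl _ _ _) (req_refl _)).
Qed.

Definition rep_alg : algebra K := Algebra rep_mulA rep_mul_bilin.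

Definition rgen (a : A) (x : M) : rep_alg := rep_pi (RGen a x).

(* The grading of A_M: rep_homog is the smallest family of submodules compatible
   with products and such that rgen a x has degree |a|. *)
Inductive rep_homog : int -> rep_alg -> Prop :=
| rep_homog_gen p a x : homog p a -> rep_homog p (rgen a x)
| rep_homog0 p : rep_homog p 0
| rep_homogD p x y : rep_homog p x -> rep_homog p y -> rep_homog p (x + y)
| rep_homogZ p k x : rep_homog p x -> rep_homog p (k *: x)
| rep_homogM p q x y : rep_homog p x -> rep_homog q y -> rep_homog (p + q) (x ** y).

(* tr_theta on A/[A,A], computed on representatives; see check_traceE. *)
Definition check_trace (theta : M) (x : check A) : rep_alg :=
  rgen (check_repr x) theta.

(* A(theta), the subalgebra of A_M generated by the rgen a theta. *)
Inductive trace_subalg (theta : M) : rep_alg -> Prop :=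
| ts_gen a : trace_subalg theta (rgen a theta)
| ts0 : trace_subalg theta 0
| tsD x y : trace_subalg theta x -> trace_subalg theta y ->
    trace_subalg theta (x + y)
| tsZ k x : trace_subalg theta x -> trace_subalg theta (k *: x)
| tsM x y : trace_subalg theta x -> trace_subalg theta y ->
    trace_subalg theta (x ** y).

End Representation.

Record is_biderivation (K : comPzRingType) (B : algebra K)
    (deg : int -> B -> Prop) (n : int) (br : B -> B -> B) : Prop :=
  IsBiderivation {
  bd_bilin : bilin br;
  bd_deg : forall p q a b, deg p a -> deg q b -> deg (p + q + n) (br a b);
  bd_derr : forall p q r a b c, deg p a -> deg q b -> deg r c ->
    br a (b ** c) = br a b ** c + sgn ((p + n) * q) *: (b ** br a c);
  bd_derl : forall p q r a b c, deg p a -> deg q b -> deg r c ->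
    br (a ** b) c = a ** br b c + sgn (q * (r + n)) *: (br a c ** b);
  bd_anti : forall p q a b, deg p a -> deg q b ->
    br a b = - (sgn ((p + n) * (q + n)) *: br b a)
}.

Section InducedBracket.
Variables (K : comPzRingType) (A : galgebra K) (M : coalgebra K).

(* br is the bracket {-,-}_v on A_M: the (unique) n-graded biderivation with
   the prescribed values on the generators. *)
Record is_induced_bracket (n : int) (D : {linear tensor A A -> tensor A A})
    (v : {scalar tensor M M}) (br : rep_alg A M -> rep_alg A M -> rep_alg A M) :
    Prop := IsInducedBracket {
  ib_biderivation : is_biderivation (@rep_homog K A M) n br;
  ib_gen : forall a b x y,
    br (rgen a x) (rgen b y) =
      sweedler3 (fun y1 y2 y3 => v (x \ot y2) *:
        tlift (fun d1 d2 => rgen d1 y1 ** rgen d2 y3) (D (a \ot b))) y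
}.

End InducedBracket.

(* Facts showing that the definitions by representatives do not depend on the
   choices: check_bracketE, rgenM and check_traceE. *)
Section LinearFacts.
Variables (K : pzRingType) (U V : lmodType K) (f : U -> V).
Hypothesis fL : linear f.
Lemma lin0 : f 0 = 0.
Proof. by have := fL (-1) 0 0; rewrite !scaleN1r !addr0 oppr0 addNr. Qed.
Lemma linD x y : f (x + y) = f x + f y.
Proof. by rewrite -[x]scale1r fL !scale1r. Qed.
Lemma linZ k x : f (k *: x) = k *: f x.
Proof. by rewrite -[k *: x]addr0 fL lin0 addr0. Qed.
Lemma linN x : f (- x) = - f x.
Proof. by rewrite -scaleN1r linZ scaleN1r. Qed.
Lemma linB x y : f (x - y) = f x - f y.
Proof. by rewrite linD linN. Qed.
Lemma lin_sum (I : Type) (r : seq I) (F : I -> U) :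
  f (\sum_(i <- r) F i) = \sum_(i <- r) f (F i).
Proof. exact: (big_morph f linD lin0). Qed.
End LinearFacts.

Lemma comp_linear (K : pzRingType) (U V W : lmodType K) (f : V -> W) (g : U -> V) :
  linear f -> linear g -> linear (fun x => f (g x)).
Proof. by move=> fL gL k x y; rewrite gL fL. Qed.

Section TensorFacts.
Variables (K : comPzRingType) (U V : lmodType K).
Lemma tensor_sum (t : tensor U V) :
  exists s : seq (U * V), t = \sum_(z <- s) z.1 \ot z.2.
Proof.
elim/tensorW: t => [|k u v t [s ->]]; first by exists [::]; rewrite big_nil.
by exists ((k *: u, v) :: s); rewrite big_cons /= (linZ ((tens_bilin U V).2 v)).
Qed.

Lemma tensor_ext (W : lmodType K) (f g : tensor U V -> W) :
  linear f -> linear g -> (forall u v, f (u \ot v) = g (u \ot v)) -> f =1 g.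
Proof.
move=> fL gL fg; elim/tensorW => [|k u v t IH]; first by rewrite (lin0 fL) (lin0 gL).
by rewrite fL gL fg IH.
Qed.
End TensorFacts.

Section GradedAlgebraFacts.
Variables (K : comPzRingType) (A : galgebra K).
Implicit Types (a b c x y : A).

Lemma homog0 p : homog p (0 : A). Proof. exact: (lin0 (gcomp_linear p)). Qed.
Lemma homogD p a b : homog p a -> homog p b -> homog p (a + b).
Proof. by rewrite /homog (linD (gcomp_linear p)) => -> ->. Qed.
Lemma homogZ p k a : homog p a -> homog p (k *: a).
Proof. by rewrite /homog (linZ (gcomp_linear p)) => ->. Qed.
Lemma homogM p q a b : homog p a -> homog q b -> homog (p + q) (a ** b).
Proof. exact: gcomp_mul. Qed.
Lemma homog_gcomp p a : homog p (gcomp a p).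
Proof. by rewrite /homog gcompK eqxx. Qed.

Lemma homogP p a q : homog p a -> gcomp a q = if p == q then a else 0.
Proof. by move=> <-; rewrite gcompK; case: eqP. Qed.

Lemma gsum_wide (W : lmodType K) (F : int -> A -> W) a (s : {fset int}) :
  (forall p, F p 0 = 0) -> (finsupp (gcomp a) `<=` s)%fset ->
  gsum F a = \sum_(p <- s) F p (gcomp a p).
Proof.
move=> F0 sub; rewrite /gsum; apply: big_fset_incl => // p _.
by rewrite memNfinsupp => /eqP ->.
Qed.

Lemma gsum_linear (W : lmodType K) (F : int -> A -> W) :
  (forall p, linear (F p)) -> linear (gsum F).
Proof.
move=> FL k a b.
have F0 p : F p 0 = 0 := lin0 (FL p).
pose s := (finsupp (gcomp a) `|` finsupp (gcomp b) `|` finsupp (gcomp (k *: a + b)))%fset.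
rewrite !(@gsum_wide _ _ _ s) //.
- by rewrite scaler_sumr -big_split; apply: eq_bigr => p _; rewrite gcomp_linear FL.
- by rewrite /s -fsetUA fsetUCA fsubsetUl.
- by rewrite /s -fsetUA fsubsetUl.
- by rewrite /s fsubsetUr.
Qed.

Lemma gsum_homog (W : lmodType K) (F : int -> A -> W) p a :
  (forall p, F p 0 = 0) -> homog p a -> gsum F a = F p a.
Proof.
move=> F0 ha; rewrite (@gsum_wide _ _ _ (p |` finsupp (gcomp a))%fset) ?fsubsetUr //.
rewrite (big_fsetD1 p) ?fset1U1 //= (homogP p ha) eqxx big1_fset ?addr0 // => q.
rewrite !inE => /andP[qp _] _; by rewrite (homogP q ha) eq_sym (negPf qp).
Qed.

Lemma homog_ind (W : lmodType K) (f g : A -> W) : linear f -> linear g ->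
  (forall p a, homog p a -> f a = g a) -> f =1 g.
Proof.
move=> fL gL fg a; rewrite (gcompE a) (lin_sum fL) (lin_sum gL).
by apply: eq_bigr => p _; apply/fg/homog_gcomp.
Qed.

Lemma amulL a : linear (fun x => a ** x). Proof. exact: (amul_bilin A).1. Qed.
Lemma amulR a : linear (fun x => x ** a). Proof. exact: (amul_bilin A).2. Qed.
Lemma otL (U V : lmodType K) (u : U) : linear (fun v : V => u \ot v).
Proof. exact: (tens_bilin U V).1. Qed.
Lemma otR (U V : lmodType K) (v : V) : linear (fun u : U => u \ot v).
Proof. exact: (tens_bilin U V).2. Qed.

Lemma scale_linear (W : lmodType K) k : linear (fun w : W => k *: w).
Proof. by move=> l x y; rewrite scalerDr !scalerA mulrC. Qed.

Lemma P21n_bilin n : bilin (fun a b => gsum (fun p a' => gsum (fun q b' =>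
    sgn ((p + n) * (q + n)) *: (b' \ot a')) b) a).
Proof.
have L b : linear (fun a : A => gsum (fun p a' => gsum (fun q b' =>
    sgn ((p + n) * (q + n)) *: (b' \ot a')) b) a).
  apply: gsum_linear => p k x y; rewrite /gsum scaler_sumr -big_split.
  by apply: eq_bigr => q _; rewrite otL; apply: scale_linear.
split=> // a k x y; rewrite /gsum scaler_sumr -big_split.
apply: eq_bigr => p _; apply: (@gsum_linear _ (fun q b' => sgn ((p + n) * (q + n)) *: (b' \ot gcomp a p))) => q l u w.
by rewrite otR; apply: scale_linear.
Qed.

Lemma P21nE n p q a b : homog p a -> homog q b ->
  P21n n (a \ot b) = sgn ((p + n) * (q + n)) *: (b \ot a).
Proof.
move=> ha hb; rewrite /P21n tliftE; last exact: P21n_bilin.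
rewrite (gsum_homog _ ha) ?(gsum_homog _ hb) // => r.
  by rewrite (lin0 (@otR _ _ _)) scaler0.
by rewrite /gsum big1 // => i _; rewrite (lin0 (@otL _ _ _)) scaler0.
Qed.

Lemma sgnK (m : int) : sgn m * sgn m = 1 :> K.
Proof. by rewrite /sgn -expr2 sqrr_sign. Qed.

Lemma sgn_odd (m : int) : sgn m = (-1) ^+ odd (absz m) :> K.
Proof. by rewrite /sgn signr_odd. Qed.

Lemma odd_absD (m n : int) : odd (absz (m + n)) = odd (absz m) (+) odd (absz n).
Proof.
suff H (k : int) : odd (absz k) = ((k %% 2)%Z != 0) by rewrite !H; lia.
by lia.
Qed.
Lemma odd_absM (m n : int) : odd (absz (m * n)) = odd (absz m) && odd (absz n).
Proof. by rewrite abszM oddM. Qed.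
Lemma sgnD (m n : int) : sgn (m + n) = sgn m * sgn n :> K.
Proof. by rewrite !sgn_odd odd_absD signr_addb. Qed.

Lemma tmul_linear : linear (@tmul K A). Proof. apply: tlift_linear; exact: amul_bilin. Qed.
Lemma tmulE a b : tmul (a \ot b) = a ** b.
Proof. rewrite /tmul tliftE //; exact: amul_bilin. Qed.

Lemma tmul_homog r (t : tensor A A) : tens_homog r t -> homog r (tmul t).
Proof.
elim=> [x [i [j [a [b [<- hi hj ->]]]]]||x y _ hx _ hy|k x _ hx].
- by rewrite tmulE; apply: homogM.
- by rewrite (lin0 tmul_linear); apply: homog0.
- by rewrite (linD tmul_linear); apply: homogD.
- by rewrite (linZ tmul_linear); apply: homogZ.
Qed.

Lemma lact_bilin a : bilin (fun x y => (a ** x) \ot y).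
Proof. by split=> [x|y] k u w; rewrite ?otL ?amulL ?otR. Qed.
Lemma ract_bilin b : bilin (fun x y => x \ot (y ** b)).
Proof. by split=> [x|y] k u w; rewrite ?amulR ?otL ?otR. Qed.

Lemma tmul_lact a (t : tensor A A) : tmul (lact a t) = a ** tmul t.
Proof.
move: t; apply: tensor_ext; first exact: comp_linear tmul_linear (tlift_linear (lact_bilin a)).
  exact: comp_linear (amulL a) tmul_linear.
by move=> u v; rewrite /lact tliftE ?tmulE ?amulA //; apply: lact_bilin.
Qed.
Lemma tmul_ract b (t : tensor A A) : tmul (ract t b) = tmul t ** b.
Proof.
move: t; apply: tensor_ext; first exact: comp_linear tmul_linear (tlift_linear (ract_bilin b)).
  exact: comp_linear (amulR b) tmul_linear.
by move=> u v; rewrite /ract tliftE ?tmulE ?amulA //; apply: ract_bilin.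
Qed.

Lemma check_pi_linear : linear (@check_pi K A).
Proof. by move=> k x y; rewrite /check_pi -(@pl_piZ K (check_pre A)) -(@pl_piD K (check_pre A)). Qed.
Lemma check_pi_eq x y : commutators (x - y) -> check_pi x = check_pi y.
Proof. by move=> H; apply/pl_piP. Qed.
Lemma check_pi_comm p q a b : homog p a -> homog q b ->
  check_pi (a ** b) = sgn (p * q) *: check_pi (b ** a).
Proof.
move=> ha hb; rewrite -(linZ check_pi_linear); apply: check_pi_eq; apply: span_gen.
by exists p, q, a, b.
Qed.

Definition cmul (t : tensor A A) : check A := check_pi (tmul t).
Lemma cmul_linear : linear cmul. Proof. exact: comp_linear check_pi_linear tmul_linear. Qed.

Lemma cmul_flip t : cmul (P21 t) = cmul t.
Proof.
move: t; apply: tensor_ext; [|exact: cmul_linear|].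
  exact: comp_linear cmul_linear (tlift_linear (P21n_bilin 0)).
move=> a b.
have L1 : linear (fun a => cmul (P21 (a \ot b))).
  apply: (comp_linear (f := fun t => cmul (P21 t))); last exact: otR.
  exact: comp_linear cmul_linear (tlift_linear (P21n_bilin 0)).
have L2 : linear (fun a => cmul (a \ot b)) := comp_linear cmul_linear (@otR _ _ b).
apply: (homog_ind L1 L2 _ a) => {L1 L2 a} p a ha.
have L1 : linear (fun b => cmul (P21 (a \ot b))).
  apply: (comp_linear (f := fun t => cmul (P21 t))); last exact: otL.
  exact: comp_linear cmul_linear (tlift_linear (P21n_bilin 0)).
have L2 : linear (fun b => cmul (a \ot b)) := comp_linear cmul_linear (@otL _ _ a).
apply: (homog_ind L1 L2 _ b) => {L1 L2 b} q b hb.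
rewrite /P21 (P21nE 0 ha hb) (linZ cmul_linear) /cmul !tmulE !addr0.
by rewrite (check_pi_comm ha hb).
Qed.

Section DoubleBracketFacts.
Variables (n : int) (D : {linear tensor A A -> tensor A A}).
Hypothesis HD : is_double_bracket n D.

Lemma cmulD_commr a x : commutators x -> cmul (D (a \ot x)) = 0.
Proof.
have L : linear (fun x => cmul (D (a \ot x))).
  apply: (comp_linear (f := fun t => cmul (D t))); last exact: otL.
  by move=> k u w; rewrite linearP cmul_linear.
elim=> {x}[x [q [r [b [c [hb hc ->]]]]]||x y _ hx _ hy|k x _ hx].
- rewrite (linB L) (linZ L).
  have L1 : linear (fun a => cmul (D (a \ot (b ** c))) - sgn (q * r) *: cmul (D (a \ot (c ** b)))).
    move=> k u w; rewrite !otR !linearP !cmul_linear !scalerDr scalerN opprD !scalerA.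
    by rewrite (mulrC k) addrACA.
  have L0 : linear (fun _ : A => 0 : check A) by move=> k u w; rewrite scaler0 addr0.
  apply: (homog_ind L1 L0 _ a) => {L L1 L0 a} p a ha.
  rewrite (db_derr HD ha hb hc) (db_derr HD ha hc hb).
  rewrite !(linD cmul_linear) !(linZ cmul_linear) /cmul !tmul_ract !tmul_lact.
  have hab := tmul_homog (db_deg HD ha hb).
  have hac := tmul_homog (db_deg HD ha hc).
  rewrite (check_pi_comm hab hc) (check_pi_comm hac hb) scalerDr !scalerA opprD.
  rewrite (addrC (- _) (- _)) addrACA -!scalerBl -!sgnD.
  set X := (X in X *: _); set Y := (Y in _ + Y *: _).
  have -> : X = 0.
    apply/eqP; rewrite subr_eq0 /X !sgn_odd !(odd_absD, odd_absM).
    by case: (odd (absz p)); case: (odd (absz q)); case: (odd (absz r)); case: (odd (absz n)).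
  have -> : Y = 0.
    apply/eqP; rewrite subr_eq0 /Y !sgn_odd !(odd_absD, odd_absM).
    by case: (odd (absz p)); case: (odd (absz q)); case: (odd (absz r)); case: (odd (absz n)).
  by rewrite !scale0r addr0.
- exact: lin0 L.
- by rewrite (linD L) hx hy addr0.
- by rewrite (linZ L) hx scaler0.
Qed.

Lemma cmulD_anti p q a b : homog p a -> homog q b ->
  cmul (D (a \ot b)) = - (sgn ((p + n) * (q + n)) *: cmul (D (b \ot a))).
Proof.
move=> ha hb; have := db_anti HD (a \ot b).
rewrite (P21nE n ha hb) => /(congr1 cmul); rewrite linearZ /= (linZ cmul_linear) (linN cmul_linear).
by rewrite cmul_flip => ->; rewrite opprK.
Qed.

Lemma cmulD_comml x b : commutators x -> cmul (D (x \ot b)) = 0.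
Proof.
move=> hx.
have L1 : linear (fun b => cmul (D (x \ot b))).
  by move=> k u w; rewrite otL linearP cmul_linear.
have L0 : linear (fun _ : A => 0 : check A) by move=> k u w; rewrite scaler0 addr0.
apply: (homog_ind L1 L0 _ b) => {L1 L0 b} q b hb.
have L : linear (fun x => cmul (D (x \ot b))).
  by move=> k u w; rewrite otR linearP cmul_linear.
elim: hx => {x}[x [p [r [a [c [ha hc ->]]]]]||x y _ hx _ hy|k x _ hx].
- have hac : homog (p + r) (a ** c - sgn (p * r) *: (c ** a)).
    apply: homogD; first exact: homogM.
    by rewrite -scaleN1r; apply/homogZ/homogZ; rewrite addrC; apply: homogM.
  rewrite (cmulD_anti hac hb) cmulD_commr ?scaler0 ?oppr0 //.
  by apply: span_gen; exists p, r, a, c.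
- exact: lin0 L.
- by rewrite (linD L) hx hy addr0.
- by rewrite (linZ L) hx scaler0.
Qed.

Lemma check_bracketE a b :
  check_bracket D (check_pi a) (check_pi b) = check_pi (tmul (D (a \ot b))).
Proof.
rewrite /check_bracket -!/(cmul _).
set a' := check_repr _; set b' := check_repr _.
have ca : commutators (a' - a) by exact: (@pl_repr_pi K (check_pre A)).
have cb : commutators (b' - b) by exact: (@pl_repr_pi K (check_pre A)).
have := cmulD_comml b' ca; rewrite (linB (@otR _ _ _)) linearB (linB cmul_linear) => /subr0_eq ->.
by have := cmulD_commr a cb; rewrite (linB (@otL _ _ _)) linearB (linB cmul_linear) => /subr0_eq ->.
Qed.
End DoubleBracketFacts.
End GradedAlgebraFacts.

Section SweedlerFacts.
Variables (K : comPzRingType) (M : coalgebra K).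

Lemma tmap_comul_bilin : bilin (fun x y : M => x \ot comul M y).
Proof. by split=> [x|y] k u w; rewrite ?linearP ?otL ?otR. Qed.

Lemma tlift_fun_linear (U V T W : lmodType K) (f : T -> U -> V -> W) t :
  (forall x, bilin (f x)) -> (forall u v, linear (fun x => f x u v)) ->
  linear (fun x => tlift (f x) t).
Proof.
move=> fB fL k u w; move: t; apply: tensor_ext => [| |y z].
- exact: tlift_linear.
- move=> l s t; rewrite !(tlift_linear (fB _)) !scalerDr !scalerA [k * l]mulrC.
  by rewrite addrACA.
- by rewrite !tliftE // fL.
Qed.

Lemma vhat_bilin (v : {scalar tensor M M}) :
  bilin (fun x y : M =>
    sweedler3 (fun y1 y2 y3 => v (x \ot y2) *: (y1 \ot y3)) y).
Proof.
have B (x y1 : M) : bilin (fun y2 y3 : M => v (x \ot y2) *: (y1 \ot y3)).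
  split=> [y2|y3] k u w; first by rewrite otL; apply: scale_linear.
  by rewrite otL linearP /= scalerDl scalerA.
have B2 (x : M) : bilin (fun (y1 : M) (y23 : tensor M M) =>
     tlift (fun y2 y3 => v (x \ot y2) *: (y1 \ot y3)) y23).
  split=> [y1|t]; first exact: tlift_linear.
  apply: tlift_fun_linear => // y2 y3 k u w.
  by rewrite otR; apply: scale_linear.
split=> [x|y].
  move=> k u w; rewrite /sweedler3 linearP.
  by rewrite [tmap _ _ _](tlift_linear tmap_comul_bilin) (tlift_linear (B2 x)).
apply: tlift_fun_linear => // y1 t; apply: tlift_fun_linear => // y2 y3 k u w.
by rewrite otR linearP /= scalerDl scalerA.
Qed.

End SweedlerFacts.

Section RepresentationFacts.
Variables (K : comPzRingType) (A : galgebra K) (M : coalgebra K).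

Lemma rgen_bilin : bilin (@rgen K A M).
Proof.
split=> [a k x y|x k a b]; rewrite /rgen -rep_piZ -rep_piD; apply/rep_piP.
- by apply: req_trans (req_genDr _ _ _) (reqD (req_genZr _ _ _) (req_refl _)).
- by apply: req_trans (req_genDl _ _ _) (reqD (req_genZl _ _ _) (req_refl _)).
Qed.

Lemma rgenM_bilin (a b : A) :
  bilin (fun x y : M => rgen a x ** rgen b y).
Proof.
have [gr gl] := rgen_bilin; have [mr ml] := amul_bilin (rep_alg A M).
by split=> [x|y] k u w; rewrite gr ?mr ?ml.
Qed.

Lemma rgenM (a b : A) (x : M) :
  rgen (a ** b) x = sweedler2 (fun x1 x2 => rgen a x1 ** rgen b x2) x.
Proof.
have [s sE] := tensor_sum (comul M x).
rewrite /sweedler2 sE (lin_sum (tlift_linear (rgenM_bilin a b))).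
have /rep_piP H := req_genM a b sE; rewrite {1}/rgen H => {H sE}.
elim: s => [|z s IH] /=; first by rewrite big_nil.
rewrite rep_piD IH big_cons; congr (_ + _).
by rewrite tliftE ?rep_piM //; apply: rgenM_bilin.
Qed.

Lemma rgenC p q (a b : A) (x y : M) : homog p a -> homog q b ->
  rgen a x ** rgen b y = sgn (p * q) *: (rgen b y ** rgen a x) :> rep_alg A M.
Proof.
move=> ha hb; rewrite /rgen /= -!rep_piM -rep_piZ.
by apply/rep_piP; apply: req_genC.
Qed.

Section TraceFacts.
Variables (v : {scalar tensor M M}) (theta : M).
Hypothesis (Hv : is_cyclic v) (Ht : is_adjoint v theta).

Lemma sweedler3_adj (W : lmodType K) (f : M -> M -> W) y : bilin f ->
  sweedler3 (fun y1 y2 y3 => v (theta \ot y2) *: f y1 y3) y = sweedler2 f y.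
Proof.
move=> fB; have [fr fl] := fB; rewrite /sweedler3 /sweedler2.
have B y1 : bilin (fun y2 y3 => v (theta \ot y2) *: f y1 y3).
  split=> [y2|y3] k u w; first by rewrite fr; apply: scale_linear.
  by rewrite otL linearP /= scalerDl scalerA.
have B2 : bilin (fun y1 (y23 : tensor M M) =>
     tlift (fun y2 y3 => v (theta \ot y2) *: f y1 y3) y23).
  split=> [y1|t]; first exact: tlift_linear.
  apply: tlift_fun_linear => // y2 y3 k u w.
  by rewrite fl; apply: scale_linear.
move: (comul M y); apply: tensor_ext => [| |y1 y2].
- exact: comp_linear (tlift_linear B2) (tlift_linear (@tmap_comul_bilin K M)).
- exact: tlift_linear.
rewrite [tmap _ _ _]tliftE; last exact: (@tmap_comul_bilin K M).
rewrite !tliftE //.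
rewrite -[in RHS](Ht y2).1 /sweedler2.
move: (comul M y2); apply: tensor_ext => [| |x1 x2].
- exact: tlift_linear.
- apply: (comp_linear (fr y1)); apply: tlift_linear.
  split=> [x|x] k u w; first exact: scale_linear.
  by rewrite otL linearP /= scalerDl scalerA.
rewrite !tliftE ?(linZ (fr y1)) //.
split=> [x|x] k u w; first exact: scale_linear.
by rewrite otL linearP /= scalerDl scalerA.
Qed.

Lemma theta_sym : tflip (comul M theta) = comul M theta.
Proof.
have E : vhat v (theta \ot theta) = comul M theta.
  rewrite /vhat tliftE; last exact: vhat_bilin.
  rewrite sweedler3_adj; last exact: tens_bilin.
  rewrite /sweedler2; move: (comul M theta); apply: tensor_ext.
  - apply: tlift_linear; exact: tens_bilin.
  - by [].
  - by move=> u w; rewrite tliftE //; exact: tens_bilin.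
rewrite -[in LHS]E -Hv [tflip _]tliftE //.
by split=> [x|x] k u w; rewrite ?otL ?otR.
Qed.

Lemma rgen_comm (x : A) : commutators x -> rgen x theta = 0.
Proof.
have L := rgen_bilin.2 theta.
elim=> {x}[x [q [r [b [c [hb hc ->]]]]]||x y _ hx _ hy|k x _ hx].
- rewrite (linB L) (linZ L); apply/eqP; rewrite subr_eq0; apply/eqP.
  rewrite !rgenM /sweedler2 -{1}theta_sym -(linZ (@tlift_linear _ _ _ _ _ (rgenM_bilin c b))).
  rewrite (linZ (@tlift_linear _ _ _ _ _ (rgenM_bilin c b))).
  have FB : bilin (fun x y : M => y \ot x) by split=> [u|u] k z w; rewrite ?otL ?otR.
  move: (comul M theta); apply: tensor_ext.
  + exact: comp_linear (tlift_linear (rgenM_bilin b c)) (tlift_linear FB).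
  + move=> k s t; rewrite (tlift_linear (rgenM_bilin c b)); exact: scale_linear.
  move=> u w; rewrite [tflip _]tliftE // !tliftE; [exact: rgenC|exact: rgenM_bilin..].
- exact: lin0 L.
- by rewrite (linD L) hx hy addr0.
- by rewrite (linZ L) hx scaler0.
Qed.

Lemma check_traceE (a : A) : check_trace theta (check_pi a) = rgen a theta.
Proof.
apply/eqP; rewrite -subr_eq0 /check_trace; set a' := check_repr _.
have ca : commutators (a' - a) by exact: (@pl_repr_pi K (check_pre A)).
by rewrite -(linB (rgen_bilin.2 theta)) rgen_comm.
Qed.

End TraceFacts.
End RepresentationFacts.

(* Main.v *)
Require Import Defs.
From HB Require Import structures.
From mathcomp Require Import all_boot all_order all_algebra finmap.
From mathcomp Require Import boolp.
Import GRing.Theory.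
Local Open Scope ring_scope.

(** Why the theorem holds. The value [{a_theta, b_theta}_v] on two traces is
    given by the double bracket and the threefold comultiplication of [theta],
    the middle factor being contracted with [v (theta (x) -)]. That form is a
    counit, so the contraction merely removes the middle factor and leaves
    [x'_{theta^1} x''_{theta^2}], where [x' (x) x''] is the double bracket of
    [a] and [b]. By the relation [(x' x'')_theta = x'_{theta^1} x''_{theta^2}]
    of the representation algebra this is the trace of [x' x'']: see
    [rgen_tmul] and [bracket_trace]. Passing to the quotient by commutators is
    then only a matter of choosing representatives; this is where the
    cyclicity of [v] enters, since it makes the trace vanish on commutators.

    Closedness of [A(theta)] follows since its generators are closed under the
    bracket and the bracket is a biderivation. As the Leibniz rules hold for
    homogeneous elements only, they are applied to the products of traces of
    homogeneous elements, which span [A(theta)] because every element of [A]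
    is the sum of its homogeneous components ([trace_subalg_span]). *)

Section TraceBracket.
Variables (K : comPzRingType) (A : galgebra K) (M : coalgebra K).

Lemma rgen_prod_bilin (x y : M) :
  bilin (fun a b : A => rgen a x ** rgen b y).
Proof.
have gL z := (@rgen_bilin K A M).2 z.
have [mr ml] := amul_bilin (rep_alg A M).
by split=> [a|b]; [apply: comp_linear (mr _) (gL y)|apply: comp_linear (ml _) (gL x)].
Qed.

Lemma rgen_tensor_bilin (t : tensor A A) :
  bilin (fun x y : M => tlift (fun a b => rgen a x ** rgen b y) t).
Proof.
split=> z; apply: tlift_fun_linear => [x|a b]; try exact: rgen_prod_bilin.
- exact: (rgenM_bilin M a b).1.
- exact: (rgenM_bilin M a b).2.
Qed.

(** The defining relation of the representation algebra for products,
    extended from pure tensors to all of [A (x) A]. *)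
Lemma rgen_tmul (t : tensor A A) (x : M) :
  rgen (tmul t) x =
  sweedler2 (fun x1 x2 => tlift (fun a b => rgen a x1 ** rgen b x2) t) x.
Proof.
move: t; apply: tensor_ext => [| |a b].
- exact: comp_linear ((@rgen_bilin K A M).2 x) (@tmul_linear K A).
- apply: tlift_fun_linear => [t|x1 x2]; first exact: rgen_tensor_bilin.
  exact: tlift_linear (rgen_prod_bilin x1 x2).
- rewrite tmulE rgenM; congr (tlift _ _).
  apply/funext=> x1; apply/funext=> x2.
  by rewrite tliftE //; apply: rgen_prod_bilin.
Qed.

Variables (n : int) (D : {linear tensor A A -> tensor A A}).
Variables (v : {scalar tensor M M}) (theta : M).
Hypothesis Htheta : is_adjoint v theta.
Variable br : rep_alg A M -> rep_alg A M -> rep_alg A M.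
Hypothesis Hbr : is_induced_bracket n D v br.

(** The counit [v (theta (x) -)] erases the middle factor of the threefold
    comultiplication of [theta], leaving the formula of [rgen_tmul]. *)
Lemma bracket_trace (a b : A) :
  br (rgen a theta) (rgen b theta) = rgen (tmul (D (a \ot b))) theta.
Proof.
rewrite (ib_gen Hbr) (sweedler3_adj Htheta) ?rgen_tmul //.
exact: rgen_tensor_bilin.
Qed.

(** Monomials carry their degree, so that the Leibniz rules apply to each of
    their factors. *)
Inductive trace_monomial : int -> rep_alg A M -> Prop :=
| tm_gen p a : homog p a -> trace_monomial p (rgen a theta)
| tm_mul p q x y : trace_monomial p x -> trace_monomial q y ->
    trace_monomial (p + q) (x ** y).

Lemma trace_monomial_homog p x : trace_monomial p x -> rep_homog p x.
Proof.
by elim=> {p x} [p a ha|p q x y _ hx _ hy]; [apply: rep_homog_gen|apply: rep_homogM].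
Qed.

Lemma trace_monomial_subalg p x : trace_monomial p x -> trace_subalg theta x.
Proof. by elim=> {p x} [p a _|p q x y _ hx _ hy]; [apply: ts_gen|apply: tsM]. Qed.

(** The span of the monomials is stable under products, and it contains
    [a_theta] for an arbitrary [a] since [a] is the sum of its components. *)
Lemma trace_subalg_span x : trace_subalg theta x ->
  Defs.span (fun z => exists p, trace_monomial p z) x.
Proof.
have [mr ml] := amul_bilin (rep_alg A M).
elim=> {x} [a||x y _ hx _ hy|k x _ hx|x y _ hx _ hy].
- rewrite (gcompE a) (lin_sum ((@rgen_bilin K A M).2 theta)).
  apply: (big_ind (Defs.span _)) => [|*|p _]; [exact: span0|exact: spanD|].
  by apply: span_gen; exists p; apply: tm_gen; apply: homog_gcomp.
- exact: span0.
- exact: spanD.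
- exact: spanZ.
- elim: hx => {x} [x [p hx]||x x' _ hx _ hx'|k x _ hx].
  + elim: hy => {y} [y [q hy]||y y' _ hy _ hy'|k y _ hy].
    * by apply: span_gen; exists (p + q); apply: tm_mul.
    * by rewrite (lin0 (mr x)); apply: span0.
    * by rewrite (linD (mr x)); apply: spanD.
    * by rewrite (linZ (mr x)); apply: spanZ.
  + by rewrite (lin0 (ml y)); apply: span0.
  + by rewrite (linD (ml y)); apply: spanD.
  + by rewrite (linZ (ml y)); apply: spanZ.
Qed.

Lemma bracket_monomial p q x y :
  trace_monomial p x -> trace_monomial q y -> trace_subalg theta (br x y).
Proof.
have Hbd := ib_biderivation Hbr => hx.
elim: hx q y => {p x} [p a ha|p p' x x' hx IHx hx' IHx'] q y hy.
- elim: hy => {q y} [q b _|q q' y y' hy IHy hy' IHy'].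
    by rewrite bracket_trace; apply: ts_gen.
  rewrite (bd_derr Hbd (rep_homog_gen theta ha)
             (trace_monomial_homog _ _ hy) (trace_monomial_homog _ _ hy')).
  have sy := trace_monomial_subalg _ _ hy; have sy' := trace_monomial_subalg _ _ hy'.
  by apply: tsD; [apply: tsM|apply/tsZ/tsM].
- rewrite (bd_derl Hbd (trace_monomial_homog _ _ hx) (trace_monomial_homog _ _ hx')
             (trace_monomial_homog _ _ hy)).
  have sx := trace_monomial_subalg _ _ hx; have sx' := trace_monomial_subalg _ _ hx'.
  by apply: tsD; [apply: tsM; last exact: IHx' _ _ hy
                 |apply/tsZ/tsM; first exact: IHx _ _ hy].
Qed.

Lemma bracket_trace_subalg x y :
  trace_subalg theta x -> trace_subalg theta y -> trace_subalg theta (br x y).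
Proof.
have [bL bR] := bd_bilin (ib_biderivation Hbr).
move=> /trace_subalg_span hx /trace_subalg_span hy.
elim: hx => {x} [x [p hx]||x x' _ hx _ hx'|k x _ hx].
- elim: hy => {y} [y [q hy]||y y' _ hy _ hy'|k y _ hy].
  + exact: bracket_monomial _ _ _ _ hx hy.
  + by rewrite (lin0 (bL x)); apply: ts0.
  + by rewrite (linD (bL x)); apply: tsD.
  + by rewrite (linZ (bL x)); apply: tsZ.
- by rewrite (lin0 (bR y)); apply: ts0.
- by rewrite (linD (bR y)); apply: tsD.
- by rewrite (linZ (bR y)); apply: tsZ.
Qed.

End TraceBracket.

Theorem lemma9p3 (K : comPzRingType) (n : int)
  (A : galgebra K) (D : {linear tensor A A -> tensor A A})
  (HD : is_double_bracket n D)
  (M : coalgebra K) (v : {scalar tensor M M}) (Hv : is_cyclic v)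
  (theta : M) (Htheta : is_adjoint v theta)
  (br : rep_alg A M -> rep_alg A M -> rep_alg A M)
  (Hbr : is_induced_bracket n D v br) :
  (forall x y : check A,
     br (check_trace theta x) (check_trace theta y)
     = check_trace theta (check_bracket D x y)) /\
  (forall x y : rep_alg A M,
     trace_subalg theta x -> trace_subalg theta y ->
     trace_subalg theta (br x y)).
Proof.
split; last exact: (bracket_trace_subalg _ _ _ _ _ _ _ Htheta _ Hbr).
(* The left side is by definition computed on representatives of x and y, so
   only the class of the product on the right needs the vanishing of the trace
   on commutators. *)
by move=> x y; rewrite (check_traceE Hv Htheta) [LHS](bracket_trace _ _ _ _ _ _ _ Htheta _ Hbr).
Qed.
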